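(* There exists a collection of $\{0,1\}$-valued random variables $\{X_q:q\in Q\}$ (with joint distribution denoted $P_\infty$) such that for every finite subset $C$ of $Q$, the collection $\{X^N_q:q\in C\}$ converges in distribution to $\{X_q:q\in C\}$ as $N\to\infty$.
   Context: $\mathbb{N}$ denotes the positive integers. $S_N(312)$ is the set of permutations $\sigma=\sigma_1\ldots\sigma_N$ of $1,\dots,N$ for which there are no indices $i_1<i_2<i_3$ with $\sigma_{i_1}>\sigma_{i_3}>\sigma_{i_2}$; $P_N$ is the uniform probability distribution on $S_N(312)$. $Q=\{(-i,j):i,j\in\mathbb{N}\}$, and $W_N=[-N,-1]\times[1,N]$. For each $N$, the random variables $\{X^N_{(-i,j)}:(-i,j)\in Q\}$ are defined by $X^N_{(-i,j)}=1$ if $(-i,j)\in W_N$ and $\sigma_{N-i+1}=j$, and $X^N_{(-i,j)}=0$ otherwise, where $\sigma$ has distribution $P_N$. *)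

(* Defs.v *)
From HB Require Import structures.
From mathcomp Require Import all_boot all_order all_algebra all_fingroup finmap.
From mathcomp Require Import all_classical all_reals all_analysis.

Set Implicit Arguments.
Unset Strict Implicit.
Unset Printing Implicit Defensive.

Import Order.TTheory GRing.Theory Num.Theory.
Import numFieldNormedType.Exports.

Local Open Scope classical_set_scope.
Local Open Scope ring_scope.

(* Positions and values are 0-based in 'S_N: the entry sigma_k of the one-line
   notation is (s (k - 1)).+1. The condition is invariant under this shift. *)
Definition avoids312 (N : nat) (s : 'S_N) : bool :=
  [forall i1 : 'I_N, forall i2 : 'I_N, forall i3 : 'I_N,
     ~~ [&& (i1 < i2)%N, (i2 < i3)%N, (s i3 < s i1)%N & (s i2 < s i3)%N]].

Definition S312 (N : nat) : predArgType := {s : 'S_N | avoids312 s}.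

HB.instance Definition _ (N : nat) :=
  Finite.copy (S312 N) {s : 'S_N | avoids312 s}.

Lemma avoids312_1 (N : nat) : avoids312 (1%g : 'S_N).
Proof.
apply/forallP => i1; apply/forallP => i2; apply/forallP => i3.
rewrite !perm1; apply/negP => /and4P[i12 i23 i31 _].
by have := ltn_trans (ltn_trans i12 i23) i31; rewrite ltnn.
Qed.

HB.instance Definition _ (N : nat) :=
  isPointed.Build (S312 N) (exist _ 1%g (avoids312_1 N)).

HB.instance Definition _ (N : nat) :=
  @isMeasurable.Build default_measure_display (S312 N)
    discrete_measurable discrete_measurable0
    discrete_measurableC discrete_measurableU.

(* Each element of S312 N has mass 1 / #|S312 N|. *)
Definition unif312 (R : realType) (N : nat) : set (S312 N) -> \bar R :=
  mscale (#|S312 N|%:R^-1)%:nng counting.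

Section unif312_probability.
Context (R : realType) (N : nat).

HB.instance Definition _ := Measure.on (@unif312 R N).

Let unif312_setT : @unif312 R N setT = 1%E.
Proof.
rewrite /unif312 /mscale /= /counting asboolT; last exact: finite_finset.
have -> : size (fset_set [set: S312 N]) = #|S312 N|.
  rewrite cardE; apply/perm_size/uniq_perm; rewrite ?fset_uniq ?enum_uniq//.
  by move=> s; rewrite (in_fset_set finite_finset) mem_enum in_setT.
rewrite -EFinM mulVf// pnatr_eq0 -lt0n.
by apply/card_gt0P; exists point.
Qed.

HB.instance Definition _ :=
  Measure_isProbability.Build _ _ _ (@unif312 R N) unif312_setT.

Definition P312 : probability (S312 N) R := @unif312 R N.

End unif312_probability.

Arguments P312 : clear implicits.

(* The set Q of the points (-i, j) with i, j >= 1. *)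
Definition site := {q : int * int | (q.1 < 0) && (0 < q.2)}.

(* W_N = [-N, -1] x [1, N]. *)
Definition window (N : nat) (q : int * int) : bool :=
  (- N%:Z <= q.1 <= -1) && (1 <= q.2 <= N%:Z).

(* For q = (-i, j): N - i + 1 = N + q.1 + 1, so the last conjunct says that
   sigma_(N - i + 1) = j. *)
Definition XN_fun (N : nat) (q : site) (s : S312 N) : bool :=
  window N (val q) &&
  [exists k : 'I_N, (k.+1%:Z == N%:Z + (val q).1 + 1) &&
                    ((val s k).+1%:Z == (val q).2)].

HB.instance Definition _ (N : nat) (q : site) :=
  @isMeasurableFun.Build _ _ (S312 N) bool (XN_fun q)
    (fun _ _ _ => I).

Definition XN (R : realType) (N : nat) (q : site) : {RV P312 R N >-> bool} :=
  @XN_fun N q.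

(* The random vector (X_q)_(q in C), with values in {0,1}^C carrying the product
   of the discrete topologies. *)
Definition joint (T : Type) (X : site -> T -> bool) (C : {fset site}) :
    T -> {ptws C -> bool} :=
  fun t c => X (val c) t.
Arguments joint {T} X C _.

(* Weak convergence of the laws of the Xn to the law of X, tested on bounded
   continuous functions; the Xn may live on different probability spaces. *)
Definition cvg_in_distribution (R : realType) (S : topologicalType)
    (dn : nat -> measure_display) (Tn : forall n, measurableType (dn n))
    (Pn : forall n, probability (Tn n) R) (Xn : forall n, Tn n -> S)
    (d : measure_display) (T : measurableType d)
    (P : probability T R) (X : T -> S) : Prop :=
  forall f : S -> R, continuous f -> bounded_fun f ->
    ('E_(Pn n)[f \o Xn n] @[n --> \oo] --> 'E_P[f \o X])%E.

(* Main.v *)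
Require Import Defs.
From HB Require Import structures.
From mathcomp Require Import all_boot all_order all_algebra all_fingroup finmap.
From mathcomp Require Import zify ring lra.
From mathcomp Require Import all_classical all_reals all_analysis.

(** The proof has two halves: the finite-dimensional laws of the X^N converge,
and their limits form a consistent family, which is realized on the unit
interval.

Convergence. Split a 312-avoiding word at its smallest letter. Avoidance forces
every letter before the minimum to be smaller than every letter after it, so
the words of size N + 1 are the [glue a b], with a and b avoiding words of sizes
k and N - k ([perm_words_index]). In particular their number c_N obeys Segner's
recursion, hence is the N-th Catalan number ([card_S312E]), and the ratios
c_N / c_{N + p} converge ([cvg_catalan_ratio]).

What a fixed window in the corner sees of [glue a b] depends on k only as
follows. If k is bounded, the window is filled by the corner of b, raised by
k + 1. If N - k is bounded, the letters of b are too large to be seen, the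
minimum is seen, and the corner of a appears behind it. For all other k the
window is empty. In both nontrivial cases only a strictly lower part of the
corner of the smaller word matters. So the mean of an observable that depends
on h + 1 rows is, up to a constant, a sum of boundedly many terms, each of which
is a constant times a convergent Catalan ratio times the mean of an observable
that depends on at most h rows ([totalS]); induction on h gives convergence
([cvg_mean]).

Realization. Enumerate Q, so that a configuration becomes a sequence of bits. The
limits nu v of the probabilities that the first bits spell v satisfy
nu v = nu (v0) + nu (v1). Cut [0, 1[ into consecutive subintervals of lengths nu v,
nested as the words v are prefixes of each other; the bits of the intervals that
contain a uniform point form a process with these laws ([bool_process]).

Finally, the expectation of a function of finitely many bits is a finite sum of
its values weighted by probabilities of words ([expectation_history]), so that
convergence of these probabilities is convergence in distribution. *)

Set Implicit Arguments.
Unset Strict Implicit.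
Unset Printing Implicit Defensive.

Import Order.TTheory GRing.Theory Num.Theory.
Import numFieldNormedType.Exports.

(** * Decomposition of 312-avoiding words at their minimum *)

Local Open Scope nat_scope.

Definition word312 (w : seq nat) : Prop :=
  forall i1 i2 i3, i1 < i2 -> i2 < i3 -> i3 < size w ->
    ~ (nth 0 w i3 < nth 0 w i1 /\ nth 0 w i2 < nth 0 w i3).

Definition one_line (N : nat) (s : S312 N) : seq nat :=
  [seq val (val s k) | k <- enum 'I_N].

(** The uniform law on [S312 N] is studied through the list of its one-line words,
because words, unlike permutations, can be cut and concatenated. *)
Definition words (N : nat) : seq (seq nat) := [seq one_line s | s <- enum {: S312 N}].

Lemma size_one_line N (s : S312 N) : size (one_line s) = N.
Proof. by rewrite size_map size_enum_ord. Qed.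

Lemma nth_one_line N (s : S312 N) (i : 'I_N) : nth 0 (one_line s) i = val s i.
Proof. by rewrite (nth_map i) ?size_enum_ord // nth_ord_enum. Qed.

Lemma one_line_inj N : injective (@one_line N).
Proof.
move=> s t est; apply/val_inj/permP => i; apply/val_inj.
by rewrite /= -!nth_one_line est.
Qed.

Lemma words_uniq N : uniq (words N).
Proof. by rewrite map_inj_uniq ?enum_uniq //; apply: one_line_inj. Qed.

Lemma mem_words N (w : seq nat) :
  reflect (perm_eq w (iota 0 N) /\ word312 w) (w \in words N).
Proof.
apply: (iffP mapP) => [[s _ ->]|[pw aw]].
  split.
    apply: uniq_perm; rewrite ?iota_uniq //.
      rewrite map_inj_uniq ?enum_uniq // => i j.
      by move=> /val_inj/perm_inj.
    move=> j; rewrite mem_iota /= add0n; apply/mapP/idP => [[i _ ->]|jN].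
      exact: ltn_ord.
    exists ((val s)^-1%g (Ordinal jN)); first by rewrite mem_enum.
    by rewrite permKV.
  move=> i1 i2 i3 i12 i23; rewrite size_one_line => i3N.
  have i2N := ltn_trans i23 i3N; have i1N := ltn_trans i12 i2N.
  rewrite -[i1]/(val (Ordinal i1N)) -[i2]/(val (Ordinal i2N)).
  rewrite -[i3]/(val (Ordinal i3N)) !nth_one_line => -[h1 h2].
  have /forallP/(_ (Ordinal i1N))/forallP/(_ (Ordinal i2N))/forallP := valP s.
  by move=> /(_ (Ordinal i3N)); rewrite i12 i23 h1 h2.
have sw : size w = N by rewrite (perm_size pw) size_iota.
have wlt (i : 'I_N) : nth 0 w i < N.
  have : nth 0 w i \in iota 0 N by rewrite -(perm_mem pw) mem_nth ?sw.
  by rewrite mem_iota.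
have uw : uniq w by rewrite (perm_uniq pw) iota_uniq.
have inj : injective (fun i : 'I_N => Ordinal (wlt i)).
  move=> i j /(congr1 val) /= /eqP; rewrite nth_uniq ?sw // => /eqP.
  exact: val_inj.
have av : avoids312 (perm inj).
  apply/forallP => i1; apply/forallP => i2; apply/forallP => i3.
  apply/negP => /and4P[i12 i23]; rewrite !permE /= => h1 h2.
  by apply: (aw i1 i2 i3 i12 i23); rewrite ?sw.
exists (exist (@avoids312 N) _ av); first by rewrite mem_enum.
apply: (@eq_from_nth _ 0); first by rewrite size_one_line.
move=> i; rewrite sw => iN.
by rewrite -[i]/(val (Ordinal iN)) nth_one_line /= permE.
Qed.

Lemma size_words N : size (words N) = #|S312 N|.
Proof. by rewrite size_map -cardE. Qed.

Lemma words_size N w : w \in words N -> size w = N.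
Proof. by case/mem_words => /perm_size ->; rewrite size_iota. Qed.

(** The only way to put a 0 between two avoiding words and avoid 312 again: the
letters of [a] become the smallest positive ones, those of [b] the largest. *)
Definition glue (a b : seq nat) : seq nat :=
  [seq x.+1 | x <- a] ++ 0 :: [seq (size a).+1 + x | x <- b].

Lemma size_glue a b : size (glue a b) = (size a + size b).+1.
Proof. by rewrite size_cat /= !size_map addnS. Qed.

Lemma nth_glue a b i : i < size (glue a b) ->
  nth 0 (glue a b) i =
    if i < size a then (nth 0 a i).+1
    else if i == size a then 0
    else (size a).+1 + nth 0 b (i - (size a).+1).
Proof.
rewrite size_glue => ib; rewrite nth_cat size_map.
case: ltnP => ia; first by rewrite (nth_map 0).
case: eqP => [->|]; first by rewrite subnn.
move=> nia; have -> : i - size a = (i - (size a).+1).+1 by lia.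
by rewrite /= (nth_map 0) //; lia.
Qed.

Lemma word_lt N w i : w \in words N -> i < N -> nth 0 w i < N.
Proof.
case/mem_words => pw _ iN.
have : nth 0 w i \in iota 0 N.
  by rewrite -(perm_mem pw) mem_nth // (perm_size pw) size_iota.
by rewrite mem_iota.
Qed.

Lemma perm_glue a b k l : perm_eq a (iota 0 k) -> perm_eq b (iota 0 l) ->
  perm_eq (glue a b) (iota 0 (k + l).+1).
Proof.
move=> pa pb; have sa : size a = k by rewrite (perm_size pa) size_iota.
rewrite /glue -cat1s perm_catCA cat1s /= perm_cons iotaD perm_cat //.
  by rewrite (iotaDl 1 0) perm_map.
by rewrite sa -[1 + k]/(k.+1) -{2}[k.+1]addn0 iotaDl perm_map.
Qed.

(** The minimum is neither the first nor the last letter of a pattern 312, and the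
letters of [a] are smaller than those of [b]; so a pattern in [glue a b] starts
and ends in the same factor, hence lies in it. *)
Lemma glue_words k l a b :
  a \in words k -> b \in words l -> glue a b \in words (k + l).+1.
Proof.
move=> aW bW; have sa := words_size aW; have sb := words_size bW.
case/mem_words: (aW) => pa va; case/mem_words: (bW) => pb vb.
apply/mem_words; split; first exact: perm_glue.
move=> i1 i2 i3 i12 i23 i3s; have := i3s; rewrite size_glue sa sb => i3kl.
rewrite !nth_glue ?size_glue ?sa ?sb; try lia.
have la i : i < k -> nth 0 a i < k by apply: word_lt aW.
have [i3k|i3k] := ltnP i3 k.
  have -> : i1 < k by lia. have -> : i2 < k by lia.
  have := va i1 i2 i3 i12 i23; rewrite sa => /(_ i3k); lia.
case: (i3 =P k) => [_|i3k']; first lia.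
have [i1k|i1k] := ltnP i1 k; first by have := la _ i1k; lia.
case: (i1 =P k) => [_|i1k']; first lia.
have -> : (i2 < k) = false by lia. have -> : (i2 == k) = false by lia.
have := vb (i1 - k.+1) (i2 - k.+1) (i3 - k.+1); rewrite sb; lia.
Qed.

(** Sorting the two factors separately sorts the concatenation, and the sorted
form of an interval is unique. *)
Lemma sorted_iota_perm a b x n : all (fun y => all (ltn y) b) a ->
  perm_eq (a ++ b) (iota x n) ->
  perm_eq a (iota x (size a)) /\ perm_eq b (iota (x + size a) (size b)).
Proof.
move=> ab p.
have e : sort leq a ++ sort leq b = iota x (size a) ++ iota (x + size a) (size b).
  rewrite -iotaD -size_cat (perm_size p) size_iota.
  apply: (sorted_eq leq_trans anti_leq).
  - rewrite sorted_pairwise; last exact: leq_trans.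
    rewrite pairwise_cat -!sorted_pairwise; try exact: leq_trans.
    rewrite !sort_sorted; try exact: leq_total.
    rewrite !andbT; apply/allrelP => y z; rewrite !mem_sort => ya zb.
    by move/allP: ab => /(_ y ya)/allP/(_ z zb)/ltnW.
  - exact: iota_sorted.
  - by rewrite (perm_trans _ p) // perm_cat // perm_sort.
have sz : size (sort leq a) = size (iota x (size a)).
  by rewrite size_sort size_iota.
move/eqP: e; rewrite eqseq_cat // => /andP[/eqP ea /eqP eb].
by rewrite -ea -eb; split; rewrite perm_sym perm_sort.
Qed.

(** The converse decomposition: a letter x before the minimum and a smaller letter y
after it would form the pattern x 0 y, which is 312. *)
Lemma words_glue N w : w \in words N.+1 -> exists a b,
  [/\ a \in words (index 0 w), b \in words (N - index 0 w) & w = glue a b].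
Proof.
move=> wW; have sw := words_size wW; case/mem_words: wW => pw vw.
have uw : uniq w by rewrite (perm_uniq pw) iota_uniq.
have w0 : 0 \in w by rewrite (perm_mem pw) mem_iota.
set k := index 0 w.
have kN : k < N.+1 by rewrite -sw index_mem.
set u := take k w; set v := drop k.+1 w.
have ew : w = u ++ 0 :: v.
  by rewrite -{1}(cat_take_drop k w) (drop_nth 0) ?sw // nth_index.
have su : size u = k by rewrite size_takel // sw ltnW.
have sv : size v = N - k by rewrite size_drop sw subSS.
have puv : perm_eq (u ++ v) (iota 1 N).
  rewrite -(perm_cons 0) -[0 :: iota 1 N]/(iota 0 N.+1) -(permPr pw) ew.
  by rewrite -cat1s perm_catCA.
have nu i : i < k -> nth 0 w i = nth 0 u i.
  by move=> ik; rewrite ew nth_cat su ik.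
have nv i : i < N - k -> nth 0 w (k.+1 + i) = nth 0 v i.
  move=> ik; rewrite ew nth_cat su.
  have -> : (k.+1 + i < k) = false by lia.
  by have -> : k.+1 + i - k = i.+1 by lia.
have pos i : i < N.+1 -> i != k -> 0 < nth 0 w i.
  move=> iN ik; rewrite lt0n -[X in _ != X](nth_index 0 w0).
  by rewrite nth_uniq ?sw.
have uv : all (fun y => all (ltn y) v) u.
  apply/allP => y /(nthP 0)[i]; rewrite su => ik <-.
  apply/allP => z /(nthP 0)[j]; rewrite sv => jk <-.
  rewrite -nu // -nv //=.
  have ne : nth 0 w i != nth 0 w (k.+1 + j) by rewrite nth_uniq ?sw; lia.
  rewrite ltn_neqAle ne /= leqNgt; apply/negP => lt.
  have := vw i k (k.+1 + j) ik; rewrite nth_index // sw.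
  have := pos (k.+1 + j); lia.
have [] := sorted_iota_perm uv puv; rewrite su sv => pu pv.
exists [seq x.-1 | x <- u], [seq x - k.+1 | x <- v]; split.
- apply/mem_words; split.
    have := perm_map predn pu; rewrite (iotaDl 1 0) -map_comp.
    by rewrite (@eq_map _ _ (predn \o addn 1) id) ?map_id.
  move=> i1 i2 i3 i12 i23; rewrite size_map su => i3k.
  rewrite !(nth_map 0) ?su; try lia.
  rewrite -!nu; try lia.
  have := vw i1 i2 i3 i12 i23; rewrite sw.
  have := pos i1; have := pos i2; have := pos i3; lia.
- apply/mem_words; split.
    have := perm_map (subn^~ k.+1) pv.
    have -> : iota (1 + k) (N - k) = map (addn k.+1) (iota 0 (N - k)).
      by rewrite -iotaDl addn0.
    rewrite -map_comp.
    rewrite (@eq_map _ _ (subn^~ k.+1 \o addn k.+1) id) ?map_id // => x.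
    by rewrite /= addKn.
  move=> i1 i2 i3 i12 i23; rewrite size_map sv => i3k.
  rewrite !(nth_map 0) ?sv; try lia.
  rewrite -!nv; try lia.
  have := vw (k.+1 + i1) (k.+1 + i2) (k.+1 + i3); rewrite sw !ltn_add2l.
  have vk i : i < N - k -> k < nth 0 v i.
    move=> ik; have : nth 0 v i \in v by rewrite mem_nth ?sv.
    by rewrite (perm_mem pv) mem_iota; lia.
  have := vk i3 i3k; rewrite -nv //; lia.
rewrite /glue size_map su -!map_comp {1}ew; congr (_ ++ _ :: _).
  rewrite -[LHS]map_id; apply/eq_in_map => x.
  by rewrite (perm_mem pu) mem_iota /= => /andP[x0 _]; rewrite prednK.
rewrite -[LHS]map_id; apply/eq_in_map => x.
by rewrite (perm_mem pv) mem_iota /= => /andP[x0 _]; rewrite subnKC.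
Qed.

Lemma index_glue a b : index 0 (glue a b) = size a.
Proof.
rewrite index_cat /= addn0 size_map ifF //.
by apply/negP => /mapP[].
Qed.

Lemma glue_inj a b a' b' : size a = size a' ->
  glue a b = glue a' b' -> a = a' /\ b = b'.
Proof.
move=> sa /eqP; rewrite eqseq_cat ?size_map // sa => /andP[/eqP ea /eqP[eb]].
by split; [apply: inj_map ea => x y []|apply: inj_map eb => x y /addnI].
Qed.

Lemma perm_words_index N k : k <= N ->
  perm_eq [seq w <- words N.+1 | index 0 w == k]
          [seq glue a b | a <- words k, b <- words (N - k)].
Proof.
move=> kN; apply: uniq_perm.
- by rewrite filter_uniq ?words_uniq.
- apply: allpairs_uniq; rewrite ?words_uniq // => -[a b] [a' b'].
  move=> /allpairsP[[x y] [/= xa _ [-> ->]]] /allpairsP[[z t] [/= za _ [-> ->]]].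
  by move=> /= /glue_inj[]; rewrite ?(words_size xa) ?(words_size za) // => -> ->.
move=> w; rewrite mem_filter; apply/andP/allpairsP.
  move=> [/eqP <- /words_glue[a [b [aW bW wE]]]].
  by exists (a, b).
move=> [[a b] [/= aW bW ->]]; rewrite index_glue (words_size aW) eqxx; split=> //.
by have := glue_words aW bW; rewrite subnKC.
Qed.

Local Open Scope ring_scope.

Lemma sum_words_glue (V : nmodType) (N : nat) (F : seq nat -> V) :
  \sum_(w <- words N.+1) F w =
  \sum_(k < N.+1) \sum_(a <- words k) \sum_(b <- words (N - k)) F (glue a b).
Proof.
transitivity (\sum_(k < N.+1) \sum_(w <- words N.+1 | index 0%N w == k) F w).
  rewrite -[LHS]big_filter (_ : [seq w <- words N.+1 | true] = words N.+1);
    last by rewrite filter_predT.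
  under [RHS]eq_bigr => k _ do rewrite big_mkcond /=.
  rewrite exchange_big /= !big_seq; apply: eq_bigr => w wW.
  have kN : (index 0%N w < N.+1)%N.
    rewrite -(words_size wW) index_mem; case/mem_words: wW => /perm_mem -> _.
    by rewrite mem_iota.
  rewrite (bigD1 (Ordinal kN)) //= eqxx big1 ?addr0 // => k.
  by rewrite -val_eqE /= eq_sym => /negbTE ->.
apply: eq_bigr => k _; rewrite -big_filter (perm_big _ (perm_words_index _)) /=.
  by rewrite big_allpairs_dep.
by rewrite -ltnS.
Qed.

Lemma card_S312_gt0 N : (0 < #|S312 N|)%N.
Proof. by apply/card_gt0P; exists point. Qed.

Lemma card_S312_0 : #|S312 0| = 1%N.
Proof.
rewrite -size_words; apply/eqP; rewrite eqn_leq size_words card_S312_gt0 andbT.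
rewrite -size_words.
suff : {subset words 0 <= [:: [::]]} by move/(uniq_leq_size (words_uniq 0)).
by move=> w /words_size/size0nil ->; rewrite inE.
Qed.

Lemma card_S312S N :
  #|S312 N.+1| = (\sum_(k < N.+1) #|S312 k| * #|S312 (N - k)|)%N.
Proof.
rewrite -size_words -sum1_size.
apply: etrans; first exact: (sum_words_glue N (fun=> 1%N)).
apply: eq_bigr => k _; rewrite -!size_words.
transitivity (\sum_(a <- words k) size (words (N - k)))%N.
  by apply: eq_bigr => a _; rewrite -sum1_size.
by rewrite big_const_seq count_predT iter_addn_0 mulnC.
Qed.

(** * The number of 312-avoiding words *)

Section catalan.
Variable R : realType.

(** The first-order recursion is the form from which the ratios of consecutive
terms can be read off; that it agrees with Segner's quadratic recursion is the
content of [catalan_convolution]. *)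
Fixpoint catalan (n : nat) : R :=
  if n is m.+1 then catalan m * (4 * m%:R + 2) / (m%:R + 2) else 1.

Lemma catalanS n : catalan n.+1 = catalan n * (4 * n%:R + 2) / (n%:R + 2).
Proof. by []. Qed.

(** Gosper's antidifference of the summand of the Catalan convolution. *)
Definition gosper (m j : nat) : R :=
  (j%:R + 1) * catalan j * ((m - j)%:R + 1) * catalan (m - j)
  * (2 * j%:R - m%:R) / (2 * m%:R * (m%:R + 1)).

Lemma gosperB n i : (i <= n)%N ->
  gosper n.+1 i.+1 - gosper n.+1 i = catalan i * catalan (n - i).
Proof.
move=> /subnK; set d := (n - i)%N => <-; rewrite /gosper.
have -> : ((d + i).+1 - i.+1 = d)%N by lia.
have -> : ((d + i).+1 - i = d.+1)%N by lia.
rewrite !catalanS -!natr1 !natrD.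
have i0 : 0 <= i%:R :> R by apply: ler0n.
have d0 : 0 <= d%:R :> R by apply: ler0n.
by field; rewrite !lt0r_neq0 //; lra.
Qed.

Lemma catalan_convolution n :
  \sum_(k < n.+1) catalan k * catalan (n - k) = catalan n.+1.
Proof.
transitivity (gosper n.+1 n.+1 - gosper n.+1 0).
  rewrite -(telescope_sumr (gosper n.+1)) // big_mkord.
  by apply: eq_bigr => k _; rewrite gosperB // -ltnS.
rewrite /gosper subnn subn0 -natr1.
have n0 : 0 <= n%:R :> R by apply: ler0n.
by rewrite [catalan 0]/=; field; rewrite !lt0r_neq0 //; lra.
Qed.

(** Both sides satisfy Segner's recursion, the left one by splitting words at their
minimum. *)
Lemma card_S312E N : #|S312 N|%:R = catalan N.
Proof.
elim/ltn_ind: N => -[|N] IH; first by rewrite card_S312_0.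
rewrite card_S312S natr_sum -catalan_convolution; apply: eq_bigr => k _.
by rewrite natrM !IH // ltnS ?leq_subr // -ltnS.
Qed.

Lemma catalan_gt0 N : 0 < catalan N.
Proof. by rewrite -card_S312E ltr0n card_S312_gt0. Qed.

(** Consecutive terms have ratio (4 N + 2) / (N + 2) = 4 - 6 / (N + 2), which tends
to 4, and the general ratio is a product of [p] inverses of such. *)
Lemma cvg_catalan_ratio p : cvgn (fun N => catalan N / catalan (N + p)).
Proof.
elim: p => [|p IH].
  rewrite (_ : (fun _ => _) = cst 1); first exact: is_cvg_cst.
  by apply/funext => N; rewrite addn0 divff // gt_eqF ?catalan_gt0.
have c1 : cvgn (fun N => catalan N / catalan N.+1).
  have -> : (fun N => catalan N / catalan N.+1) =
            (fun N => (4 - 6 * harmonic N.+1)^-1).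
    apply/funext => N; rewrite catalanS /harmonic /= -!natr1.
    have := lt0r_neq0 (catalan_gt0 N); have n0 : 0 <= N%:R :> R by apply: ler0n.
    move=> c0; field; rewrite c0 /= !lt0r_neq0 //; lra.
  have h4 : ((4 - 6 * harmonic N.+1 : R) @[N --> \oo] --> (4 : R))%classic.
    rewrite -[X in (_ --> X)%classic](subr0 4) -[X in _ - X](mulr0 6).
    apply: cvgB; first exact: cvg_cst.
    have h0 := @cvg_harmonic R; rewrite -cvg_shiftS in h0.
    by apply: cvgM; [exact: cvg_cst|exact: h0].
  by apply: is_cvgV (cvgP _ h4); rewrite (cvg_lim _ h4) // lt0r_neq0.
have -> : (fun N => catalan N / catalan (N + p.+1)) =
    (fun N => (catalan N / catalan (N + p)) *
              (catalan (N + p) / catalan (N + p).+1)).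
  apply/funext => N; rewrite addnS mulrA divfK // gt_eqF ?catalan_gt0 //.
apply: is_cvgM => //.
by have /cvg_ex[l] := c1; rewrite -(cvg_shiftn p) => /cvgP.
Qed.
End catalan.

(** * The corner of a word *)

Definition config := nat -> nat -> bool.

(** The picture of a word seen from its last position and its smallest letter:
column i is the i-th position from the end, row j is the letter j, both counted
from 0. *)
Definition corner (w : seq nat) : config :=
  fun i j => (i < size w)%N && (nth 0%N w (size w - i.+1) == j).

(** The corner of [glue a b] as long as it is filled by [b], with [t] letters below
it. *)
Definition raise (t : nat) (x : config) : config :=
  fun i j => (t <= j)%N && x i (j - t)%N.

(** The corner of [glue a b] when the letters of [b], of size [l], are out of sight:
[l] empty columns, then the minimum in row 0, then the corner of [a]. *)
Definition shift_behind (l : nat) (x : config) : config :=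
  fun i j => if (i < l)%N then false
             else if i == l then j == 0%N
             else (0 < j)%N && x (i - l.+1)%N j.-1.

Definition empty_config : config := fun _ _ => false.

Lemma corner_glue a b i j : corner (glue a b) i j =
  if (i < size b)%N then raise (size a).+1 (corner b) i j
  else shift_behind (size b) (corner a) i j.
Proof.
rewrite /corner /raise /shift_behind.
have [ib|ib] := boolP (i < (size (glue a b)))%N; last first.
  move: ib; rewrite size_glue /= => ib.
  do !case: ifPn => ?; lia.
rewrite nth_glue; last by rewrite size_glue; lia.
move: ib; rewrite size_glue /= => ib.
case: (ltnP i (size b)) => il /=.
  rewrite !ifF; try lia.
  have -> : ((size a + size b).+1 - i.+1 - (size a).+1 = size b - i.+1)%N by lia.
  by lia.
case: (i =P size b) => [->|il'].
  rewrite ifF ?ifT; lia.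
rewrite ifT; last lia.
have -> : (i - (size b).+1 < size a)%N by lia.
have -> : ((size a + size b).+1 - i.+1 = size a - (i - (size b).+1).+1)%N by lia.
by case: j => //; rewrite andbF.
Qed.

(** * Convergence of means of local observables *)

Section limits.
Variable R : realType.

Definition local_obs (w h : nat) (F : config -> R) : Prop := forall x y,
  (forall i j, (i < w)%N -> (j < h)%N -> x i j = y i j) -> F x = F y.

Definition total (N : nat) (F : config -> R) : R := \sum_(s <- words N) F (corner s).

Lemma local_raise w h h' t (F : config -> R) : (h <= t + h')%N -> local_obs w h F ->
  local_obs w h' (F \o raise t).
Proof.
move=> hh lF x y xy; apply: lF => i j iw jh; rewrite /raise.
by case: leqP => //= tj; apply: xy => //; lia.
Qed.

Lemma local_shift w h l (F : config -> R) : local_obs w h.+1 F ->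
  local_obs w h (F \o shift_behind l).
Proof.
move=> lF x y xy; apply: lF => i j iw jh; rewrite /shift_behind.
case: ltnP => // li; case: eqP => // il; case: j jh => //= j jh.
by apply: xy; lia.
Qed.

Lemma sum_ends (V : zmodType) (N w h : nat) (t : nat -> V) :
  (h + w <= N.+1)%N -> (forall k, (h <= k)%N -> (k + w <= N)%N -> t k = 0) ->
  \sum_(k < N.+1) t k = \sum_(k < h) t k + \sum_(l < w) t (N - l)%N.
Proof.
move=> hw t0; rewrite -(big_mkord xpredT t) (@big_cat_nat _ _ _ h) //=; last lia.
rewrite big_mkord; congr (_ + _).
rewrite (@big_cat_nat _ _ _ (N.+1 - w)%N) /=; [|lia|lia].
rewrite big_nat_cond big1 ?add0r; last first.
  by move=> k /andP[/andP[hk kN] _]; apply: t0; lia.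
rewrite big_nat_rev -{1}[(N.+1 - w)%N]add0n big_addn.
rewrite subKn; last lia.
rewrite big_mkord; apply: eq_bigr => l _; congr t.
have := ltn_ord l; lia.
Qed.

Lemma sum_const N (c : R) : \sum_(s <- words N) c = catalan R N * c.
Proof.
by rewrite big_const_seq count_predT size_words iter_addr_0 -card_S312E mulr_natl.
Qed.

(** The renewal equation. When the minimum is at a position k with h <= k <= N - w,
the window of [w] columns and [h] rows is empty and contributes
[F empty_config = 0]; the first sum collects the k < h and the second the
N - k < w. *)
Lemma totalS w h N (F : config -> R) : (h + w <= N.+1)%N -> local_obs w h F ->
  F empty_config = 0 ->
  total N.+1 F =
    \sum_(k < h) catalan R k * total (N - k) (F \o raise k.+1) +
    \sum_(l < w) catalan R l * total (N - l) (F \o shift_behind l).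
Proof.
move=> hw lF F0; rewrite /total sum_words_glue.
rewrite (@sum_ends _ N w h (fun k => \sum_(a <- words k)
    \sum_(b <- words (N - k)) F (corner (glue a b)))) //.
  congr (_ + _); apply: eq_bigr => -[k kh] _ /=.
  - transitivity (\sum_(a <- words k) total (N - k) (F \o raise k.+1)).
      rewrite big_seq [RHS]big_seq; apply: eq_bigr => a aW.
      rewrite /total big_seq [RHS]big_seq; apply: eq_bigr => b bW.
      apply: lF => i j iw jh.
      rewrite corner_glue (words_size aW) (words_size bW) ifT //; lia.
    by rewrite sum_const.
  - transitivity (\sum_(a <- words (N - k))
        catalan R k * F (shift_behind k (corner a))).
      rewrite big_seq [RHS]big_seq; apply: eq_bigr => a aW.
      have -> : (N - (N - k) = k)%N by lia.
      rewrite -sum_const; rewrite big_seq [RHS]big_seq.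
      apply: eq_bigr => b bW; apply: lF => i j iw jh.
      rewrite corner_glue (words_size aW) (words_size bW).
      rewrite /raise /shift_behind; case: ltnP => // ik.
      by have -> : ((N - k).+1 <= j)%N = false by lia.
    by rewrite mulr_sumr.
move=> k hk kw; rewrite big_seq big1 // => a aW; rewrite big_seq big1 // => b bW.
rewrite -F0; apply: lF => i j iw jh.
rewrite corner_glue (words_size aW) (words_size bW) ifT; last lia.
by rewrite /raise; have -> : (k.+1 <= j)%N = false by lia.
Qed.

Definition mean (N : nat) (F : config -> R) : R := total N F / catalan R N.

Lemma mean_cst N (c : R) : mean N (fun=> c) = c.
Proof.
rewrite /mean /total sum_const mulrC mulKf // gt_eqF //.
exact: catalan_gt0.
Qed.

Lemma is_cvg_sum (I : Type) (r : seq I) (u : I -> nat -> R) :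
  (forall i, cvgn (u i)) -> cvgn (fun n => \sum_(i <- r) u i n).
Proof.
move=> cu; apply: (cvgP (\sum_(i <- r) limn (u i))).
by apply: (cvg_big add_continuous) => i _; apply: cu.
Qed.

(** The terms of [totalS], divided by the number of words, have this shape. *)
Lemma cvg_mean_step (F : config -> R) (c : R) k :
  cvgn (mean^~ F) -> cvgn (fun N => c * total (N - k) F / catalan R N.+1).
Proof.
move=> cF.
have : cvgn (fun N => c * (mean N F * (catalan R N / catalan R (N + k.+1)))).
  apply: is_cvgM; first exact: is_cvg_cst.
  by apply: is_cvgM => //; apply: cvg_catalan_ratio.
move=> /cvg_ex[l]; rewrite -(cvg_centern k) => cl.
apply: (cvgP l); apply: cvg_trans cl; apply: near_eq_cvg.
exists k => // N /= kN.
have -> : (N - k + k.+1 = N.+1)%N by lia.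
by rewrite -mulrA /mean (mulrA (_ / _)) divfK // gt_eqF ?catalan_gt0.
Qed.

(** Induction on the number of rows [h]: both [raise] and [shift_behind] move the
picture up by at least one row, so the observables on the right of [totalS] see
fewer rows. *)
Lemma cvg_mean w h (F : config -> R) : local_obs w h F -> cvgn (mean^~ F).
Proof.
elim: h F => [|h IH] F lF.
  have -> : mean^~ F = fun=> F empty_config.
    apply/funext => N; rewrite -(mean_cst N (F empty_config)) /mean /total.
    by congr (_ / _); apply: eq_bigr => s _; apply: lF.
  exact: is_cvg_cst.
(* The renewal equation needs an observable that vanishes on the empty window. *)
pose G x := F x - F empty_config.
have lG : local_obs w h.+1 G by move=> x y xy; rewrite /G (lF x y).
have -> : mean^~ F = fun N => mean N G + F empty_config.
  apply/funext => N; rewrite -{1}(mean_cst N (F empty_config)) /mean /total.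
  rewrite -mulrDl -big_split /=; congr (_ / _).
  by apply: eq_bigr => s _; rewrite subrK.
apply: is_cvgD; last exact: is_cvg_cst.
have : cvgn (fun N =>
    (\sum_(k < h.+1)
       catalan R k * total (N - k) (G \o raise k.+1) / catalan R N.+1) +
    (\sum_(l < w)
       catalan R l * total (N - l) (G \o shift_behind l) / catalan R N.+1)).
  apply: is_cvgD; apply: is_cvg_sum => k; apply: cvg_mean_step; apply: IH.
    by apply: local_raise lG; lia.
  exact: local_shift.
move=> /cvg_ex[l cl]; apply: (cvgP l); rewrite -cvg_shiftS.
apply: cvg_trans cl; apply: near_eq_cvg; exists (h.+1 + w)%N => // N /= hN.
rewrite /mean (totalS _ lG); [|lia|by rewrite /G subrr].
by rewrite -!mulr_suml -mulrDl.
Qed.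

End limits.

Local Open Scope classical_set_scope.
Local Open Scope ring_scope.

(** The first [n] bits, the most recent one first, so that one more bit is a [cons]. *)
Fixpoint history (x : nat -> bool) (n : nat) : seq bool :=
  if n is m.+1 then x m :: history x m else [::].

Lemma size_history x n : size (history x n) = n.
Proof. by elim: n => //= n ->. Qed.

Lemma nth_history x n i : (i < n)%N -> nth false (history x n) (n - i.+1) = x i.
Proof.
elim: n => // n IH; rewrite subSS ltnS leq_eqVlt => /predU1P[->|i_n].
  by rewrite subnn.
by rewrite -(subnSK i_n) /= IH.
Qed.

(** * A process of bits with prescribed consistent laws *)

Section unif01.
Variable R : realType.

Let I01 : set (measurableTypeR R) := `[0, 1[.

Let mI01 : measurable I01.
Proof. exact: measurable_itv. Qed.

(** Restricting Lebesgue measure to the half-open interval makes the half-open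
pieces of the subdivision tile it exactly. *)
Definition unif01 : set (measurableTypeR R) -> \bar R :=
  mrestr lebesgue_measure mI01.

HB.instance Definition _ := Measure.on unif01.

Let unif01T : unif01 setT = 1%E.
Proof.
by rewrite /unif01 /mrestr setTI lebesgue_measure_itv /= lte_fin ltr01 sube0.
Qed.

HB.instance Definition _ :=
  Measure_isProbability.Build _ _ _ unif01 unif01T.

Definition P01 : probability (measurableTypeR R) R := unif01.

Variable nu : seq bool -> R.
Hypothesis nu1 : nu [::] = 1.
Hypothesis nu_ge0 : forall v, 0 <= nu v.
Hypothesis nuE : forall v, nu v = nu (false :: v) + nu (true :: v).

(** The word [v] is given the interval of length [nu v] that starts at [left_end v].
It is cut into the interval of [false :: v], on the left, and that of
[true :: v]. *)
Fixpoint left_end (v : seq bool) : R :=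
  if v is b :: v' then left_end v' + (if b then nu (false :: v') else 0) else 0.

Fixpoint address (u : R) (n : nat) : seq bool :=
  if n is m.+1 then
    let v := address u m in (left_end v + nu (false :: v) <= u) :: v
  else [::].

Definition digit (n : nat) (u : measurableTypeR R) : bool :=
  left_end (address u n) + nu (false :: address u n) <= u.

Lemma addressE u n : address u n = history (digit^~ u) n.
Proof. by elim: n => //= n <-. Qed.

(** The address of a point spells [v] exactly when the point lies in the interval of
[v]: a point of that interval goes to the right half iff it is at least the cut
[left_end v + nu (false :: v)]. *)
Lemma address_itv u v : 0 <= u < 1 ->
  (address u (size v) == v) = (left_end v <= u < left_end v + nu v).
Proof.
move=> u01; elim: v => [|b v IH]; first by rewrite /= nu1 add0r u01 eqxx.
rewrite [address _ _]/= eqseq_cons.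
have [/eqP e|ne] := boolP (address u (size v) == v); last first.
  rewrite andbF; apply/esym/negP => h; move/negP: ne; apply; rewrite IH.
  move: h (nu_ge0 (false :: v)) (nu_ge0 (true :: v)); rewrite /= (nuE v).
  by case: b; lra.
have := IH; rewrite e eqxx => /esym; rewrite (nuE v) => h; rewrite andbT /=.
move: (nu_ge0 (false :: v)) (nu_ge0 (true :: v)) h.
case: b; rewrite /= ?eqb_id ?eqbF_neg -?ltNge => ? ? ?;
  by apply/idP/andP => [?|[? ?]]; first split; lra.
Qed.

Lemma measurable_address n v : measurable [set u : measurableTypeR R | address u n = v].
Proof.
elim: n v => [|n IH] [|b v].
- by rewrite (_ : [set _ | _] = setT) //; apply/seteqP; split.
- by rewrite (_ : [set _ | _] = set0) //; apply/seteqP; split.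
- by rewrite (_ : [set _ | _] = set0) //; apply/seteqP; split.
have -> : [set u : measurableTypeR R | address u n.+1 = b :: v] =
    [set u | address u n = v] `&`
    (if b then [set` `[left_end v + nu (false :: v), +oo[] else
       [set` `]-oo, left_end v + nu (false :: v)[]).
  apply/seteqP; split => u /=.
    by move=> [<- <-]; split=> //; case: leP => h /=; rewrite in_itv /= ?h.
  move=> [->]; case: b; rewrite /= in_itv /= ?andbT; first by move=> ->.
  by rewrite ltNge => /negbTE ->.
apply: measurableI => //.
by case: b; exact: measurable_itv.
Qed.

Lemma measurable_digit n : measurable_fun setT (digit n).
Proof.
apply: (measurable_fun_bool true); rewrite setTI.
have -> : digit n @^-1` [set true] =
    \bigcup_(v in [set: seq bool]) [set u | address u n.+1 = true :: v].
  apply/seteqP; split => u /=; last by move=> [v _ []].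
  by move=> h; exists (address u n) => //; exact: (congr1 (cons^~ _) h).
apply: countable_bigcupT_measurable; first exact: countableP.
by move=> v; exact: measurable_address.
Qed.

Lemma unif01_address v :
  P01 [set u | history (digit^~ u) (size v) = v] = (nu v)%:E.
Proof.
rewrite /P01 /= /unif01 /mrestr.
have -> : [set u | history (digit^~ u) (size v) = v] `&` I01 =
    `[left_end v, left_end v + nu v[ `&` I01.
  apply/seteqP; split => u /= []; rewrite -addressE !in_itv /= => /[swap] u01.
    by move=> /eqP; rewrite address_itv.
  by rewrite -address_itv // => /eqP ->.
rewrite setIidl.
  rewrite lebesgue_measure_itv /= lte_fin ltrDl -EFinD addrAC subrr add0r.
  by case: ltgtP (nu_ge0 v) => // <-.
(* The interval of v lies in [0, 1[, so the restriction loses nothing. *)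
have : 0 <= left_end v /\ left_end v + nu v <= 1.
  elim: v => [|b v [l0 l1]]; first by rewrite /= nu1 add0r.
  move: l0 l1 (nu_ge0 (false :: v)) (nu_ge0 (true :: v)); rewrite (nuE v) /=.
  by case: b; lra.
move=> [l0 l1] u; rewrite /I01 /= !in_itv /= => /andP[lu ur].
by rewrite (le_trans l0 lu) (lt_le_trans ur l1).
Qed.

End unif01.

(** Kolmogorov extension for sequences of bits. *)
Lemma bool_process (R : realType) (nu : seq bool -> R) :
  nu [::] = 1 -> (forall v, 0 <= nu v) ->
  (forall v, nu v = nu (false :: v) + nu (true :: v)) ->
  exists X : nat -> {RV P01 R >-> bool},
    forall v, P01 R [set u | history (fun i => X i u) (size v) = v] = (nu v)%:E.
Proof.
move=> nu1 nu0 nuE.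
pose X n : {RV P01 R >-> bool} := HB.pack (@digit R nu n)
  (isMeasurableFun.Build _ _ _ _ (@digit R nu n) (measurable_digit nu n)).
exists X => v; exact: unif01_address.
Qed.

(** The words of length [n] partition the probability space, and the integrand is
constant on each part. *)
Lemma expectation_history (R : realType) d (T : measurableType d)
    (P : probability T R) (X : nat -> {RV P >-> bool}) (g : seq bool -> R) n :
  ('E_P[fun t => g (history (fun i => X i t) n)] =
  \sum_(v : n.-tuple bool)
    (g v)%:E * P [set t | history (fun i => X i t) (size v) = v])%E.
Proof.
pose F (v : n.-tuple bool) := [set t | history (fun i => X i t) (size v) = v].
have mF v : measurable (F v).
  rewrite /F; case: v => v /= _; elim: v => [|b v IH].
    by rewrite (_ : [set _ | _] = setT) //; apply/seteqP; split.
  have -> : [set t | history (fun i => X i t) (size (b :: v)) = b :: v] =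
      (X (size v) @^-1` [set b]) `&`
      [set t | history (fun i => X i t) (size v) = v].
    by apply/seteqP; split => t /= [-> ->].
  apply: measurableI => //.
  by rewrite -[X in measurable X]setTI; apply: measurable_funP.
rewrite unlock.
transitivity (\int[P]_t (\sum_(v : n.-tuple bool) (g v)%:E * (\1_(F v) t)%:E))%E.
  apply: eq_integral => t _.
  have hs : size (history (fun i => X i t) n) == n by rewrite size_history.
  rewrite (bigD1 (Tuple hs)) //= big1 ?adde0.
    by rewrite indicE mem_set ?mule1 //= /F /= size_history.
  move=> v vne; rewrite indicE memNset ?mule0 // => /= e.
  by move/eqP: vne; apply; apply/val_inj; rewrite /= -e size_tuple.
rewrite integral_sum //; last first.
  by move=> v; apply: integrableZl => //; exact: integrable_indic.
apply: eq_bigr => v _; rewrite integralZl //; last exact: integrable_indic.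
by rewrite integral_indic // setIT.
Qed.

(** * The sites as coordinates of the corner *)

(** The site (-i, j) is column i - 1 and row j - 1 of the corner. *)
Definition col (q : site) : nat := `|(val q).1|%N.-1.
Definition row (q : site) : nat := `|(val q).2|%N.-1.

Lemma XN_corner N (q : site) (s : S312 N) :
  XN_fun q s = corner (one_line s) (col q) (row q).
Proof.
rewrite /XN_fun /window /corner size_one_line /col /row.
case: q => -[a b] /= /andP[a0 b0].
apply/andP/andP => [[/andP[/andP[Na a1] /andP[b1 bN]]]|].
  move=> /existsP[k /andP[/eqP ka /eqP kb]].
  split; first lia.
  have -> : (N - `|a|.-1.+1)%N = k :> nat by lia.
  by rewrite nth_one_line -kb.
move=> [aN /eqP]; have kN : (N - `|a|.-1.+1 < N)%N by lia.
rewrite -[(N - _)%N]/(val (Ordinal kN)) nth_one_line => kb.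
have := ltn_ord (val s (Ordinal kN)); rewrite kb => bN.
split; first lia.
by apply/existsP; exists (Ordinal kN); rewrite kb /=; lia.
Qed.

(** Reading the sites in the order of their codes turns a configuration into a
sequence of bits. *)
Definition bit (x : config) (i : nat) : bool :=
  if choice.unpickle i is Some q then x (col q) (row q) else false.

Arguments mean {R} N F.

(** * The limit law *)

Section limit_law.
Variable R : realType.

Definition hits (v : seq bool) (x : config) : R :=
  (history (bit x) (size v) == v)%:R.

(** Finitely many bits look at finitely many sites, which fit in a window. *)
Lemma local_hits v : exists w h, local_obs w h (hits v).
Proof.
suff [w [h wh]] : exists w h, forall x y : config,
    (forall i j, (i < w)%N -> (j < h)%N -> x i j = y i j) ->
    history (bit x) (size v) = history (bit y) (size v).
  by exists w, h => x y xy; rewrite /hits (wh x y).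
elim: (size v) => [|n [w [h IH]]]; first by exists 0%N, 0%N.
pose c := if choice.unpickle n is Some q then (col q).+1 else 0%N.
pose r := if choice.unpickle n is Some q then (row q).+1 else 0%N.
exists (maxn w c), (maxn h r) => x y xy /=; congr cons.
  rewrite /bit; move: xy; rewrite /c /r; case: choice.unpickle => // q xy.
  by apply: xy; rewrite leq_max leqnn orbT.
by apply: IH => i j iw jh; apply: xy; rewrite leq_max ?iw ?jh.
Qed.

Lemma cvg_hits v : cvgn (mean^~ (hits v)).
Proof. by have [w [h /cvg_mean]] := local_hits v. Qed.

Definition limit_law (v : seq bool) : R := limn (mean^~ (hits v)).

Lemma limit_law_nil : limit_law [::] = 1.
Proof.
rewrite /limit_law (_ : mean^~ _ = cst 1) ?lim_cst //.
by apply/funext => N; exact: mean_cst.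
Qed.

Lemma limit_law_ge0 v : 0 <= limit_law v.
Proof.
apply: limr_ge; first exact: cvg_hits.
apply: nearW => N; apply: divr_ge0; last exact/ltW/catalan_gt0.
by apply: sumr_ge0 => s _; apply: ler0n.
Qed.

Lemma limit_lawE v : limit_law v = limit_law (false :: v) + limit_law (true :: v).
Proof.
rewrite /limit_law -limD; try exact: cvg_hits.
have -> // : mean^~ (hits v) =
  mean^~ (hits (false :: v)) + mean^~ (hits (true :: v)).
apply/funext => N; rewrite /mean /total fctE -mulrDl -big_split; congr (_ / _).
apply: eq_bigr => s _; rewrite /hits /= !eqseq_cons.
by case: bit; case: eqP; rewrite ?addr0 ?add0r.
Qed.

Definition XN_bit (N i : nat) : {RV P312 R N >-> bool} :=
  if choice.unpickle i is Some q then XN R N q else cst false.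

Lemma XN_bitE N i s : XN_bit N i s = bit (corner (one_line s)) i.
Proof.
rewrite /XN_bit /bit; case: choice.unpickle => // q; exact: XN_corner.
Qed.

Lemma P312_hits N v :
  P312 R N [set s | history (fun i => XN_bit N i s) (size v) = v] =
  (mean N (hits v))%:E.
Proof.
rewrite /P312 /= /unif312 /mscale /= /counting asboolT; last exact: finite_finset.
rewrite -EFinM mulrC /mean card_S312E; congr (_ / _)%:E.
set A := [set _ | _].
have -> : #|` fset_set A| = count (fun s => s \in A) (enum {: S312 N}).
  rewrite -size_filter; apply/perm_size/uniq_perm.
  - exact: fset_uniq.
  - by rewrite filter_uniq ?enum_uniq.
  by move=> s; rewrite (in_fset_set finite_finset) mem_filter mem_enum andbT.
rewrite -sum1_count natr_sum big_mkcond /= /total /words [RHS]big_map.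
apply: eq_bigr => s _; rewrite /hits.
have -> : (s \in A) = (history (bit (corner (one_line s))) (size v) == v).
  have e : history (fun i => XN_bit N i s) (size v) =
      history (bit (corner (one_line s))) (size v).
    by elim: (size v) => //= n ->; rewrite XN_bitE.
  by apply/idP/eqP; rewrite inE /A /= e.
by case: eqP.
Qed.

End limit_law.

Theorem theorem2p17 (R : realType) :
  exists (d : measure_display) (T : measurableType d) (P : probability T R)
         (X : site -> {RV P >-> bool}),
    forall C : {fset site},
      cvg_in_distribution
        (fun N => P312 R N) (fun N => joint (XN R N) C)
        P (joint X C).
Proof.
have [X XE] := bool_process (limit_law_nil R) (@limit_law_ge0 R) (@limit_lawE R).
exists _, _, (P01 R), (fun q => X (choice.pickle q)) => C f _ _.
(* A number of bits that covers all the sites of C. *)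
pose n := (\max_(q <- C) (choice.pickle q).+1)%N.
have Cn (c : C) : (choice.pickle (val c) < n)%N.
  rewrite /n; apply: (@leq_bigmax_seq _ _ _ (fun q => (choice.pickle q).+1)) => //.
  exact: valP.
(* Bit i < n is entry n - i.+1 of the history, the most recent bit being first. *)
pose g (v : seq bool) : R :=
  f (fun c : C => nth false v (n - (choice.pickle (val c)).+1)).
have EN N : 'E_(P312 R N)[f \o joint (XN R N) C]%E =
    (\sum_(v : n.-tuple bool) g v * mean N (hits R v))%:E.
  transitivity ('E_(P312 R N)[fun s => g (history (fun i => XN_bit R N i s) n)]%E).
    congr ('E_(_)[_])%E; apply/funext => s /=; congr f; apply/funext => c.
    by rewrite nth_history // /XN_bit choice.pickleK.
  rewrite expectation_history -sumEFin; apply: eq_bigr => v _.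
  by rewrite P312_hits EFinM.
have EX : 'E_(P01 R)[f \o joint (fun q => X (choice.pickle q)) C]%E =
    (\sum_(v : n.-tuple bool) g v * limit_law R v)%:E.
  transitivity ('E_(P01 R)[fun s => g (history (fun i => X i s) n)]%E).
    congr ('E_(_)[_])%E; apply/funext => s /=; congr f; apply/funext => c.
    by rewrite nth_history.
  rewrite expectation_history -sumEFin; apply: eq_bigr => v _.
  by rewrite XE EFinM.
rewrite EX (_ : (fun N => _) = EFin \o
  (fun N => \sum_(v : n.-tuple bool) g v * mean N (hits R v))); last exact/funext.
apply: cvg_EFin; first by apply: nearW.
apply: (cvg_big add_continuous) => v _.
by apply: cvgM; [exact: cvg_cst|exact: cvg_hits].
Qed.
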